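(* Let $g\in C^{1,1}$ be a Riemannian metric on $\mathbb R^d$ such that $(\mathbb R^d,g)$ is geodesically complete, with generalized smooth embedding $\tilde g=[g^\varepsilon_{ij}(-)]$, each $g^\varepsilon$ being a smooth Riemannian metric. Let $p,q\in\mathbb R^d$, $p\ne q$, let $u\in C^{2,1}([0,1],\mathbb R^d)$ be a solution of the geodesic equation $\ddot u=-\Gamma_{ij}(u)\dot u^i\dot u^j$ with $u(0)=p$, $u(1)=q$, let $y_\varepsilon\in C^\infty([0,1],\mathbb R^d)$ (for $\varepsilon$ small) be the solution of $\ddot y=-\Gamma^\varepsilon_{ij}(y)\dot y^i\dot y^j$, $y(0)=p$, $\dot y(0)=\dot u(0)$, with $y_\varepsilon(1)=q$, and let $y=[y_\varepsilon(-)]\in\mathcal{GC}^\infty_{>0}(p,q)$. Let $\lambda\in\mathcal{GC}^\infty_{>0}(p,q)$ be a minimizer of $L_{\tilde g}$ and assume that for $\varepsilon$ small, $y_\varepsilon$ is $L_{g^\varepsilon}$-minimizing. Then $L_{\tilde g}(y)=L_{\tilde g}(\lambda)$.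
   Context: Generalized numbers. Let $I_0=(0,1]\subseteq\mathbb R$; ''for $\varepsilon$ small'' means for all $\varepsilon\in(0,\varepsilon_0]$ for some $\varepsilon_0\in I_0$. Fix a net $\rho=(\rho_\varepsilon)_{\varepsilon\in I_0}$ of reals with $\rho_\varepsilon\to0^+$ as $\varepsilon\to0^+$. A net $(x_\varepsilon)$ in $\mathbb R^n$ is moderate if $|x_\varepsilon|=O(\rho_\varepsilon^{-N})$ for some $N\in\mathbb R_{>0}$; $(x_\varepsilon)\sim(y_\varepsilon)$ if $|x_\varepsilon-y_\varepsilon|=O(\rho_\varepsilon^{N})$ for every $N\in\mathbb R_{>0}$. $\widetilde{\mathbb R}$ is the ring of moderate real nets modulo $\sim$, with classes $[x_\varepsilon]$; $\widetilde{\mathbb R}^n$ is defined analogously. $\mathbb R\subseteq\widetilde{\mathbb R}$ via constant nets; $d\rho=[\rho_\varepsilon]$. $x\le y$ iff there are representatives with $x_\varepsilon\le y_\varepsilon$ for all $\varepsilon$; $x<y$ iff $y-x\ge0$ and $y-x$ is invertible; $|[x_\varepsilon]|=[|x_\varepsilon|]$. For generalized curves, $[0,1]=\{x\in\widetilde{\mathbb R}:0\le x\le1\}$. For $x=[x_\varepsilon]>0$, $x^{1/2}=[\sqrt{x_\varepsilon}]$. Generalized smooth functions (GSF). For open $\Omega_\varepsilon\subseteq\mathbb R^n$, $\langle\Omega_\varepsilon\rangle$ is the set of $[x_\varepsilon]\in\widetilde{\mathbb R}^n$ such that for every representative $x_\varepsilon\in\Omega_\varepsilon$ for $\varepsilon$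 small. For $X\subseteq\widetilde{\mathbb R}^n$, $Y\subseteq\widetilde{\mathbb R}^k$, $\mathcal{GC}^\infty(X,Y)$ is the set of maps $f:X\to Y$ for which there are $f_\varepsilon\in C^\infty(\Omega_\varepsilon,\mathbb R^k)$ with $X\subseteq\langle\Omega_\varepsilon\rangle$, $f([x_\varepsilon])=[f_\varepsilon(x_\varepsilon)]$ and $(\partial^\alpha f_\varepsilon(x_\varepsilon))$ moderate for all $[x_\varepsilon]\in X$ and all multi-indices $\alpha$. Derivatives and integrals are computed $\varepsilon$-wise. Embedding and regularized metric. Fix $b=[b_\varepsilon]\in\widetilde{\mathbb R}$ with $b\ge d\rho^{-N}$ for some $N\in\mathbb R_{>0}$ and $\psi_\varepsilon\in C_c^\infty(\mathbb R^d)$ with support in the unit ball, $\int\psi_\varepsilon=1$, $\sup|\partial^\alpha\psi_\varepsilon|=O(b_\varepsilon^{k})$ for some $k=k(\alpha)\in\mathbb N$, for each $j\in\mathbb N$ all moments of order $1,\ldots,j$ of $\psi_\varepsilon$ vanishing for $\varepsilon$ small, and for each $\eta\in\mathbb R_{>0}$, $\int|\psi_\varepsilon|\le1+\eta$ for $\varepsilon$ small; put $\psi^b_\varepsilon(x)=b_\varepsilon^d\psi_\varepsilon(b_\varepsilon x)$. The embedding $\iota$ of distributions into GSF is the unique sheaf morphism extending $T\mapsto[(T*\psi^b_\varepsilon)(-)]$ from compactly supported distributions. The net $(g^\varepsilon_{ij})$ is chosen so that $\tilde g_{ij}=\iota(g_{ij})=[g^\varepsilon_{ij}(-)]$, regarded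 as GSF on $\widetilde{\mathbb R}^d$, and each $g^\varepsilon$ is a smooth Riemannian metric on $\mathbb R^d$; $\Gamma_{ij}$ and $\Gamma^\varepsilon_{ij}$ are the ($\mathbb R^d$-valued) Christoffel symbols of $g$ and $g^\varepsilon$, and $g^\varepsilon\to g$, $\Gamma^\varepsilon_{ij}\to\Gamma_{ij}$ locally uniformly. Lengths. $\mathcal{GC}^\infty_{>0}(p,q)=\{\lambda\in\mathcal{GC}^\infty([0,1],\widetilde{\mathbb R}^d):\lambda(0)=p,\ \lambda(1)=q,\ |\dot\lambda(t)|>0\ \forall t\in[0,1]\}$. For such $\lambda$, $L_{\tilde g}(\lambda)=\int_0^1(\tilde g_{ij}(\lambda(t))\dot\lambda^i(t)\dot\lambda^j(t))^{1/2}dt\in\widetilde{\mathbb R}$ (summation over repeated indices). $\lambda$ is a minimizer of $L_{\tilde g}$ if $L_{\tilde g}(\lambda)\le L_{\tilde g}(\mu)$ for all $\mu\in\mathcal{GC}^\infty_{>0}(p,q)$. $y_\varepsilon$ is $L_{g^\varepsilon}$-minimizing if its $g^\varepsilon$-length is minimal among all curves in $\mathbb R^d$ from $p$ to $q$. *)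

(* Defs.v *)
From HB Require Import structures.
From mathcomp Require Import all_boot all_order all_algebra.
From mathcomp Require Import ring_quotient generic_quotient.
From mathcomp Require Import all_classical all_reals all_analysis.
Set Implicit Arguments. Unset Strict Implicit. Unset Printing Implicit Defensive.
Import Order.TTheory GRing.Theory Num.Theory.
Import numFieldNormedType.Exports.
Local Open Scope classical_set_scope.
Local Open Scope ring_scope.
Local Open Scope quotient_scope.

(* Nets are indexed by all of R instead of ]0, 1]: moderateness and negligibility
   only look at small positive parameters, so the values elsewhere are
   irrelevant; conditions required "for all parameters" are restricted to I0. *)

Record ggauge (R : realType) := Gauge {
  gauge_fun :> R -> R;
  gaugeP : gauge_fun @ 0^'+ --> 0^'+ }.

Definition I0 {R : realType} : set R := [set e | 0 < e <= 1].

Section GeneralizedNumbers.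
Context {R : realType} (rho : ggauge R).

Lemma gauge_gt0 : \forall e \near 0^'+, 0 < rho e.
Proof. exact: (gaugeP rho (nbhs_right_gt 0)). Qed.

Lemma gauge_le1 : \forall e \near 0^'+, rho e <= 1.
Proof. exact: (gaugeP rho (nbhs_right_le ltr01)). Qed.

Section Space.
Variable V : normedModType R.


Definition isO (x : R -> V) (r : R -> R) := exists C, \forall e \near 0^'+, `|x e| <= C * r e.

(* On row vectors `|_| is the sup norm, which gives the same moderate and
   negligible nets as the Euclidean norm. *)
Definition moderate : {pred R -> V} :=
  fun x => `[< exists2 N, 0 < N & isO x (fun e => rho e `^ (- N)) >].

Lemma moderate_zmod : zmod_closed moderate.
Proof.
split=> [|x y /asboolP[N N0 [C hC]] /asboolP[M M0 [D hD]]]; apply/asboolP.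
  by exists 1 => //; exists 0; near=> e; rewrite normr0 mul0r.
exists (N + M); first exact: addr_gt0.
exists (`|C| + `|D|); near=> e.
have r0 : 0 < rho e by near: e; exact: gauge_gt0.
have r1 : rho e <= 1 by near: e; exact: gauge_le1.
rewrite mulrDl (le_trans (ler_normB _ _))// lerD//.
- have h : `|x e| <= C * rho e `^ (- N) by near: e.
  rewrite (le_trans h)// (@le_trans _ _ (`|C| * rho e `^ (- N)))//.
    by rewrite ler_wpM2r ?powR_ge0 ?ler_norm.
  by rewrite ler_wpM2l// ger_powR ?r0// lerN2 lerDl ltW.
- have h : `|y e| <= D * rho e `^ (- M) by near: e.
  rewrite (le_trans h)// (@le_trans _ _ (`|D| * rho e `^ (- M)))//.
    by rewrite ler_wpM2r ?powR_ge0 ?ler_norm.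
  by rewrite ler_wpM2l// ger_powR ?r0// lerN2 lerDr ltW.
Unshelve. all: by end_near. Qed.

HB.instance Definition _ := GRing.isZmodClosed.Build (R -> V) moderate moderate_zmod.

Record mnet := MNet { mnet_val :> R -> V; mnetP : mnet_val \in moderate }.
HB.instance Definition _ := [isSub for mnet_val].
HB.instance Definition _ := [Choice of mnet by <:].
HB.instance Definition _ := [SubChoice_isSubZmodule of mnet by <:].

Definition negligible : {pred mnet} :=
  fun x => `[< forall N, 0 < N -> isO (mnet_val x) (fun e => rho e `^ N) >].

Lemma negligible_zmod : zmod_closed negligible.
Proof.
split=> [|x y /asboolP hx /asboolP hy]; apply/asboolP => N N0.
  by exists 0; near=> e; rewrite normr0 mul0r.
have [C hC] := hx _ N0; have [D hD] := hy _ N0.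
exists (C + D); near=> e.
rewrite mulrDl (le_trans (ler_normB _ _))// lerD//; by near: e.
Unshelve. all: by end_near. Qed.

HB.instance Definition _ := GRing.isZmodClosed.Build mnet negligible negligible_zmod.

Definition gspace := Quotient.quot negligible.
HB.instance Definition _ := GRing.Zmodule.on gspace.


(* The class of a net; the default value 0 is only used if x is not moderate. *)
Definition gclass (x : R -> V) : gspace := \pi_(gspace) (insubd (0 : mnet) x).
End Space.
Arguments moderate : clear implicits.
Arguments negligible : clear implicits.
Arguments mnet : clear implicits.
Arguments gspace : clear implicits.

Lemma moderate1 : 1 \in moderate R.
Proof.
apply/asboolP; exists 1 => //; exists 1; near=> e.
rewrite normr1 mul1r powRN powRr1; last by rewrite ltW//; near: e; exact: gauge_gt0.
rewrite invr_ge1 ?unitf_gt0//; near: e; [exact: gauge_le1|exact: gauge_gt0|exact: gauge_gt0].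
Unshelve. all: by end_near. Qed.

Lemma moderateM : GRing.mulr_2closed (moderate R).
Proof.
move=> x y /asboolP[N N0 [C hC]] /asboolP[M M0 [D hD]]; apply/asboolP.
exists (N + M); first exact: addr_gt0.
exists (C * D); near=> e.
have r0 : 0 < rho e by near: e; exact: gauge_gt0.
rewrite normrM opprD powRD; last by rewrite (lt0r_neq0 r0) implybT.
by rewrite mulrACA ler_pM//; near: e.
Unshelve. all: by end_near. Qed.

Definition mnet_one : mnet R := MNet moderate1.
Definition mnet_mul (x y : mnet R) : mnet R :=
  MNet (moderateM (mnetP x) (mnetP y)).

Lemma mnet_mulA : associative mnet_mul.
Proof. by move=> x y z; apply: val_inj; rewrite /= mulrA. Qed.

Lemma mnet_mulC : commutative mnet_mul.
Proof. by move=> x y; apply: val_inj; rewrite /= mulrC. Qed.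

Lemma mnet_mul1 : left_id mnet_one mnet_mul.
Proof. by move=> x; apply: val_inj; rewrite /= mul1r. Qed.

Lemma mnet_mulDl : left_distributive mnet_mul +%R.
Proof. by move=> x y z; apply: val_inj; rewrite /= mulrDl. Qed.

Lemma mnet_oner_neq0 : mnet_one != 0.
Proof. by rewrite -val_eqE /=; exact: oner_neq0. Qed.

HB.instance Definition _ := @GRing.Zmodule_isComNzRing.Build (mnet R)
  mnet_one mnet_mul mnet_mulA mnet_mulC mnet_mul1 mnet_mulDl mnet_oner_neq0.

Lemma negligible_ideal : 1 \notin negligible R /\
  forall a, {in negligible R : {pred mnet R}, forall u, a * u \in negligible R}.
Proof.
split=> [|a u /asboolP hu].
  apply/negP => /asboolP/(_ 1 ltr01)[C hC].
  have c0 : 0 < (`|C| + 1)^-1 by rewrite invr_gt0 ltr_wpDl.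
  have hlt := gaugeP rho (nbhs_right_lt c0).
  have [e [[r0 rC]]] : exists e, (0 < rho e /\ rho e < (`|C| + 1)^-1) /\
      `|(1 : R)| <= C * rho e `^ 1.
    by apply: (@filter_ex _ (0 : R)^'+); near=> e; split; [split|]; near: e => //; exact: gauge_gt0.
  rewrite normr1 powRr1 ?(ltW r0)// => h; suff: C * rho e < 1 by rewrite ltNge h.
  rewrite (@le_lt_trans _ _ ((`|C| + 1) * rho e))//.
    by rewrite ler_wpM2r ?(ltW r0)// (le_trans (ler_norm _))// lerDl.
  by rewrite -ltr_pdivlMl ?mulr1// ltr_wpDl.
apply/asboolP => N N0.
have /asboolP[M M0 [C hC]] := mnetP a.
have [D hD] := hu (N + M) (addr_gt0 N0 M0).
exists (C * D); near=> e.
have r0 : 0 < rho e by near: e; exact: gauge_gt0.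
rewrite normrM (_ : rho e `^ N = rho e `^ (- M) * rho e `^ (N + M)); last first.
  by rewrite -powRD ?(lt0r_neq0 r0) ?implybT// addrC addrK.
by rewrite mulrACA ler_pM//; near: e.
Unshelve. all: by end_near. Qed.

HB.instance Definition _ := isProperIdeal.Build (mnet R) (negligible R) negligible_ideal.
HB.instance Definition _ := GRing.ComNzRing.on (gspace R).

End GeneralizedNumbers.
Arguments moderate {R} rho V.
Arguments negligible {R} rho V.
Arguments mnet {R} rho V.
Arguments gspace {R} rho V.
Arguments gclass {R} rho {V} x.

Section Order.
Context {R : realType} (rho : ggauge R).
Implicit Types x y : gspace rho R.

Definition rep (V : normedModType R) (a : R -> V) (x : gspace rho V) :=
  a \in moderate rho V /\ gclass rho a = x.

Definition gle x y := exists a b : R -> R,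
  [/\ rep a x, rep b y & forall e, I0 e -> a e <= b e].

Definition ginvertible x := exists z, z * x = 1.

Definition glt x y := gle 0 (y - x) /\ ginvertible (y - x).

Definition gint01 : set (gspace rho R) := [set t | gle 0 t /\ gle t 1].

Definition enorm n (v : 'rV[R]_n) : R := Num.sqrt (\sum_i v 0 i ^+ 2).

Definition gnorm n (x : gspace rho 'rV[R]_n) : gspace rho R :=
  gclass rho (fun e => enorm (repr x e)).

End Order.
Arguments gint01 {R} rho.

Section PartialDerivatives.
Context {R : realType} {V W : normedModType R} {I : Type} (B : I -> V).

(* The multi-index alpha is encoded by a list s of coordinates in which i occurs
   alpha_i times, so that |alpha| = size s; B is the standard basis of V. *)
Fixpoint pderive (s : seq I) (f : V -> W) : V -> W :=
  if s is i :: s' then fun x => 'D_(B i) (pderive s' f) x else f.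

Definition Ck_on (k : nat) (Om : set V) (f : V -> W) :=
  forall (s : seq I) x, Om x ->
    ((size s <= k)%N -> {for x, continuous (pderive s f)}) /\
    ((size s < k)%N -> forall i, derivable (pderive s f) x (B i)).

Definition Cinf_on (Om : set V) (f : V -> W) := forall k, Ck_on k Om f.

End PartialDerivatives.

Definition rvbasis {R : realType} n (i : 'I_n) : 'rV[R]_n := delta_mx 0 i.
Definition rbasis {R : realType} (i : unit) : R := 1.

Section GeneralizedSmoothFunctions.
Context {R : realType} (rho : ggauge R) {V W : normedModType R} {I : Type}.
Variable B : I -> V.

Definition strong_membership (Om : R -> set V) : set (gspace rho V) :=
  [set x | forall a, rep a x -> \forall e \near 0^'+, Om e (a e)].

Definition gsf_net (X : set (gspace rho V)) (fe : R -> V -> W)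
    (f : gspace rho V -> gspace rho W) :=
  exists Om : R -> set V,
    [/\ forall e, I0 e -> open (Om e) /\ Cinf_on B (Om e) (fe e),
        X `<=` strong_membership Om
      & forall x a, X x -> rep a x ->
          (forall s, (fun e => pderive B s (fe e) (a e)) \in moderate rho W) /\
          rep (fun e => fe e (a e)) (f x)].

Definition GCinf (X : set (gspace rho V)) (Y : set (gspace rho W))
    (f : gspace rho V -> gspace rho W) :=
  {homo f : x / X x >-> Y x} /\ exists fe, gsf_net X fe f.

Definition compactly_supported (Om : set V) : set (gspace rho V) :=
  [set x | exists K a, [/\ compact K, K `<=` Om, rep a x
                         & \forall e \near 0^'+, K (a e)]].

End GeneralizedSmoothFunctions.

Section Embedding.
Context {R : realType} (rho : ggauge R).

(* Integral over R^n; it is only applied to continuous functions with compact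
   support, for which the iterated integral is the n-dimensional one. *)
Fixpoint integral_rV n : ('rV[R]_n -> R) -> R :=
  if n is m.+1 then fun f =>
    (\int[lebesgue_measure]_t integral_rV (fun x : 'rV_m => f (row_mx t%:M x)))%R
  else fun f => f 0.

Definition convolution n (f h : 'rV[R]_n -> R) (x : 'rV[R]_n) : R :=
  integral_rV (fun z => f z * h (x - z)).

Variables (d : nat) (b : R -> R) (psi : R -> 'rV[R]_d -> R).

Record mollifier : Prop := {
  scale_moderate : b \in moderate rho R ;
  scale_large : exists2 N, 0 < N &
    gle (gclass rho (fun e => rho e `^ (- N))) (gclass rho b) ;
  mollifier_smooth : forall e, I0 e -> Cinf_on (@rvbasis R d) setT (psi e) ;
  mollifier_support : forall e, I0 e -> forall x, psi e x != 0 -> enorm x <= 1 ;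
  mollifier_integral : forall e, I0 e -> integral_rV (psi e) = 1 ;
  mollifier_bound : forall s : seq 'I_d, exists (k : nat) (C : R),
    \forall e \near 0^'+, forall x,
      `|pderive (@rvbasis R d) s (psi e) x| <= C * b e ^+ k ;
  mollifier_moments : forall j : nat, \forall e \near 0^'+,
    forall s : seq 'I_d, (0 < size s <= j)%N ->
      integral_rV (fun x => (\prod_(i <- s) x 0 i) * psi e x) = 0 ;
  mollifier_L1 : forall eta, 0 < eta ->
    \forall e \near 0^'+, integral_rV (fun x => `|psi e x|) <= 1 + eta }.

Definition psi_b (e : R) (x : 'rV[R]_d) : R := b e ^+ d * psi e (b e *: x).

(* F is the embedding iota f of the continuous function f on compactly supported
   points: since iota is a sheaf morphism and f = chi f on Om, its restriction to
   Om is that of iota (chi f) = [(chi f) * psi_b], chi f being compactly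
   supported; the sets Om as below cover R^d. *)
Definition is_embedding (f : 'rV[R]_d -> R)
    (F : gspace rho 'rV[R]_d -> gspace rho R) :=
  forall (Om : set 'rV[R]_d) (chi : 'rV[R]_d -> R),
    open Om -> Cinf_on (@rvbasis R d) setT chi ->
    compact (closure [set x | chi x != 0]) ->
    (forall x, Om x -> chi x = 1) ->
  forall x a, compactly_supported Om x -> rep a x ->
    rep (fun e => convolution (fun z => chi z * f z) (psi_b e) (a e)) (F x).

End Embedding.

Section Curves.
Context {R : realType} {V : normedModType R}.
Implicit Types (A : set R) (c : R -> V).

(* Derivative along A, which is one-sided at the end points of an interval. *)
Definition dquot c (t s : R) : V := (s - t)^-1 *: (c s - c t).
Definition dwithin A c (t : R) : V := lim (dquot c t @ within A t^').

Definition Ck_within (k : nat) A c := forall j,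
  ((j <= k)%N -> {within A, continuous (iter j (dwithin A) c)}) /\
  ((j < k)%N -> forall t, A t ->
     cvg (dquot (iter j (dwithin A) c) t @ within A t^')).

Definition piecewise_C1 c := exists s : seq R,
  [/\ path <%R 0 s, last 0 s = 1
    & forall i, (i < size s)%N -> Ck_within 1 `[nth 0 (0 :: s) i, nth 0 s i] c].

End Curves.

Section RiemannianGeometry.
Context {R : realType} {d : nat}.
Implicit Types (h : 'rV[R]_d -> 'M[R]_d) (c : R -> 'rV[R]_d).

Definition C11_metric h := forall i j,
  Ck_on (@rvbasis R d) 1 setT (fun x => h x i j) /\
  forall k (x : 'rV[R]_d), exists2 U, nbhs x U &
    [lipschitz 'D_(rvbasis k) (fun z => h z i j) y | y in U].

Definition smooth_metric h :=
  forall i j, Cinf_on (@rvbasis R d) setT (fun x => h x i j).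

Definition qform (G : 'M[R]_d) (v : 'rV[R]_d) : R :=
  \sum_i \sum_j G i j * v 0 i * v 0 j.

Definition riemannian h := forall x,
  (h x)^T = h x /\ forall v, v != 0 -> 0 < qform (h x) v.

(* The k-th component of christoffel h i j x is Gamma^k_ij(x). *)
Definition christoffel h (i j : 'I_d) (x : 'rV[R]_d) : 'rV[R]_d :=
  \row_k (2^-1 * \sum_l invmx (h x) k l *
    ('D_(rvbasis i) (fun z => h z j l) x + 'D_(rvbasis j) (fun z => h z i l) x
     - 'D_(rvbasis l) (fun z => h z i j) x)).

Definition geodesic h (A : set R) c := Ck_within 2 A c /\
  forall t, A t -> let v := dwithin A c t in
    iter 2 (dwithin A) c t =
      - \sum_i \sum_j (v 0 i * v 0 j) *: christoffel h i j (c t).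

Definition geodesically_complete h := forall (J : set R) c,
  open J -> is_interval J -> geodesic h J c ->
  exists2 c', geodesic h setT c' & {in J, c' =1 c}.

Definition curve_length h c : R :=
  (\int[lebesgue_measure]_(t in `[0, 1])
     Num.sqrt (qform (h (c t)) (dwithin `[0, 1] c t)))%R.

(* The competitors are the piecewise C^1 curves from p to q. *)
Definition length_minimizing h (p q : 'rV[R]_d) c := forall c',
  piecewise_C1 c' -> c' 0 = p -> c' 1 = q -> curve_length h c <= curve_length h c'.

End RiemannianGeometry.

Section GeneralizedCurves.
Context {R : realType} (rho : ggauge R) {d : nat}.
Implicit Types (lam : gspace rho R -> gspace rho 'rV[R]_d).

(* Some net defining the generalized smooth curve lam on [0, 1]; neither the derivative nor the length below
   depends on its choice. *)
Definition curve_net lam : R -> R -> 'rV[R]_d :=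
  xget (fun _ _ => 0) [set c | gsf_net (@rbasis R) (gint01 rho) c lam].

Definition gderive lam (t : gspace rho R) : gspace rho 'rV[R]_d :=
  gclass rho (fun e => derive1 (curve_net lam e) (repr t e)).

Definition GCpos (p q : 'rV[R]_d) lam :=
  [/\ GCinf (@rbasis R) (gint01 rho) setT lam,
      lam 0 = gclass rho (fun=> p),
      lam 1 = gclass rho (fun=> q)
    & forall t, gint01 rho t -> glt 0 (gnorm (gderive lam t))].

(* The length of lam for the generalized metric [ge e (-)], with the square root
   and the integral taken parameterwise. *)
Definition glength (ge : R -> 'rV[R]_d -> 'M[R]_d) lam : gspace rho R :=
  gclass rho (fun e => curve_length (ge e) (curve_net lam e)).

Definition glength_minimizer ge (p q : 'rV[R]_d) lam :=
  forall mu, GCpos p q mu -> gle (glength ge lam) (glength ge mu).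

End GeneralizedCurves.

(* Main.v *)
(* Minimality of lambda gives L(lambda) <= L(y).  Conversely, a net (c_e)
   defining lambda only satisfies c_e(0) ~ p and c_e(1) ~ q, so y_e is not
   compared with c_e but with c_e plus an affine map of negligible coefficients
   that moves the ends to p and q exactly.  Nets of curves that are close up to
   negligible errors together with their first derivatives have lengths that
   differ by a negligible net, because |sqrt a - sqrt b| <= sqrt |a - b|.  For
   two nets defining the same generalized curve, closeness of the derivatives
   follows from that of the values by Landau-Kolmogorov interpolation, the
   second derivatives being moderate. *)
Require Import Defs.
From mathcomp Require Import all_boot all_order all_algebra.
From mathcomp Require Import ring_quotient.
From mathcomp Require Import ring lra.
From mathcomp Require Import all_classical all_reals all_analysis.
Import Order.TTheory GRing.Theory Num.Theory.
Import numFieldNormedType.Exports.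
Local Open Scope classical_set_scope.
Local Open Scope ring_scope.
Set Implicit Arguments. Unset Strict Implicit. Unset Printing Implicit Defensive.

(** * Calculus of moderate and negligible nets *)

Section Nets.
Context {R : realType} (rho : ggauge R).

(** The condition defining [negligible], put on raw nets so that it makes sense before moderateness
    is known. *)
Definition neglnet (V : normedModType R) (x : R -> V) :=
  forall N, 0 < N -> isO x (fun e => rho e `^ N).

(** One spare power of the gauge absorbs the constant, since [C * rho e <= 1] for [e] small. *)
Lemma isO_gauge_drop (V : normedModType R) (x : R -> V) N :
  isO x (fun e => rho e `^ (N + 1)) ->
  \forall e \near 0^'+, `|x e| <= rho e `^ N.
Proof.
move=> [C hC].
have c0 : 0 < (`|C| + 1)^-1 by rewrite invr_gt0 ltr_wpDl.
near=> e.
have r0 : 0 < rho e by near: e; exact: gauge_gt0.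
have rC : rho e <= (`|C| + 1)^-1.
  by near: e; exact: (gaugeP rho (nbhs_right_le c0)).
have h : `|x e| <= C * rho e `^ (N + 1) by near: e.
rewrite (le_trans h)// powRD ?(lt0r_neq0 r0) ?implybT// powRr1 ?(ltW r0)//.
rewrite mulrCA ger_pMr ?powR_gt0//.
rewrite (@le_trans _ _ ((`|C| + 1) * rho e))//.
  by rewrite ler_wpM2r ?(ltW r0)// (le_trans (ler_norm _))// lerDl.
by rewrite -ler_pdivlMl ?mulr1// ltr_wpDl.
Unshelve. all: by end_near. Qed.

Lemma neglnetP (V : normedModType R) (x : R -> V) :
  neglnet x <-> forall N, 0 < N -> \forall e \near 0^'+, `|x e| <= rho e `^ N.
Proof.
split=> [h N N0|h N N0]; last by exists 1; near=> e; rewrite mul1r; near: e; exact: h.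
by apply: isO_gauge_drop; apply: h; rewrite addr_gt0.
Unshelve. all: by end_near. Qed.

Lemma moderateP (V : normedModType R) (x : R -> V) : x \in moderate rho V <->
  exists2 N, 0 < N & \forall e \near 0^'+, `|x e| <= rho e `^ (- N).
Proof.
split=> [/asboolP[N N0 h]|[N N0 h]].
  exists (N + 1); first by rewrite addr_gt0.
  by apply: isO_gauge_drop; rewrite opprD subrK.
by apply/asboolP; exists N => //; exists 1; near=> e; rewrite mul1r; near: e.
Unshelve. all: by end_near. Qed.

Lemma moderate_le (V W : normedModType R) (x : R -> V) (y : R -> W) :
  x \in moderate rho V -> (\forall e \near 0^'+, `|y e| <= `|x e|) ->
  y \in moderate rho W.
Proof.
move=> /moderateP[N N0 h] yx; apply/moderateP; exists N => //.
by near=> e; apply: (@le_trans _ _ `|x e|); near: e.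
Unshelve. all: by end_near. Qed.

Lemma neglnet_le (V W : normedModType R) (x : R -> V) (y : R -> W) :
  neglnet x -> (\forall e \near 0^'+, `|y e| <= `|x e|) -> neglnet y.
Proof.
move=> /neglnetP h yx; apply/neglnetP => N N0; have hN := h _ N0.
by near=> e; apply: (@le_trans _ _ `|x e|); near: e.
Unshelve. all: by end_near. Qed.

Lemma moderate_bounded (V : normedModType R) (x : R -> V) (C : R) :
  (\forall e \near 0^'+, `|x e| <= C) -> x \in moderate rho V.
Proof.
move=> h; apply/asboolP; exists 1 => //; exists `|C|; near=> e.
have r0 : 0 < rho e by near: e; exact: gauge_gt0.
have xC : `|x e| <= C by near: e.
rewrite (le_trans xC)// (le_trans (ler_norm C))// ler_peMr//.
rewrite powRN powRr1 ?(ltW r0)// invr_ge1 ?unitf_gt0//.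
by near: e; exact: gauge_le1.
Unshelve. all: by end_near. Qed.

Lemma neglnet_moderate (V : normedModType R) (x : R -> V) :
  neglnet x -> x \in moderate rho V.
Proof.
move=> /neglnetP/(_ 1 ltr01) h; apply: (@moderate_bounded _ _ 1); near=> e.
have r0 : 0 < rho e by near: e; exact: gauge_gt0.
have xe : `|x e| <= rho e `^ 1 by near: e.
by rewrite (le_trans xe)// powRr1 ?(ltW r0)//; near: e; exact: gauge_le1.
Unshelve. all: by end_near. Qed.

Lemma neglnetD (V : normedModType R) (x y : R -> V) :
  neglnet x -> neglnet y -> neglnet (fun e => x e + y e).
Proof.
move=> hx hy N N0; have [C hC] := hx _ N0; have [D hD] := hy _ N0.
by exists (C + D); near=> e; rewrite mulrDl (le_trans (ler_normD _ _))// lerD//; near: e.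
Unshelve. all: by end_near. Qed.

Lemma neglnet0 (V : normedModType R) : neglnet (fun=> 0 : V).
Proof. by move=> N N0; exists 0; near=> e; rewrite normr0 mul0r.
Unshelve. all: by end_near. Qed.

Lemma neglnet_norm (V : normedModType R) (x : R -> V) :
  neglnet x -> neglnet (fun e => `|x e|).
Proof. by move=> h; apply: neglnet_le h _; near=> e; rewrite normr_id.
Unshelve. all: by end_near. Qed.

Lemma neglnet_sum (V : normedModType R) (I : Type) (r : seq I) (P : pred I)
    (x : I -> R -> V) : (forall i, neglnet (x i)) ->
  neglnet (fun e => \sum_(i <- r | P i) x i e).
Proof.
move=> h; elim: r => [|i r IH].
  by under eq_fun do rewrite big_nil; exact: neglnet0.
by under eq_fun do rewrite big_cons; case: (P i) => //; exact: neglnetD.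
Qed.

Lemma neglnetM (x y : R -> R) :
  x \in moderate rho R -> neglnet y -> neglnet (fun e => x e * y e).
Proof.
move=> /asboolP[M M0 [C hC]] hy N N0; have [D hD] := hy _ (addr_gt0 N0 M0).
exists (C * D); near=> e.
have r0 : 0 < rho e by near: e; exact: gauge_gt0.
rewrite normrM (_ : rho e `^ N = rho e `^ (- M) * rho e `^ (N + M)); last first.
  by rewrite -powRD ?(lt0r_neq0 r0) ?implybT// addrC addrK.
by rewrite mulrACA ler_pM//; near: e.
Unshelve. all: by end_near. Qed.

Lemma neglnetM2 (a b x y : R -> R) :
  a \in moderate rho R -> neglnet (fun e => a e - b e) ->
  x \in moderate rho R -> neglnet (fun e => x e - y e) ->
  neglnet (fun e => a e * x e - b e * y e).
Proof.
move=> ma ab mx xy.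
(* Expansion around [a] and [x]: each term has a negligible factor, and the remaining factors are
   [a], [x] and the negligible [a - b]. *)
have -> : (fun e => a e * x e - b e * y e) =
   fun e => a e * (x e - y e) + (x e * (a e - b e) + - (a e - b e) * (x e - y e)).
  by apply/funext => e; ring.
apply: neglnetD; first exact: neglnetM.
apply: neglnetD; first exact: neglnetM.
apply: neglnetM => //; apply: neglnet_moderate.
by apply: neglnet_le ab _; near=> e; rewrite normrN.
Unshelve. all: by end_near. Qed.

Lemma neglnet_sqrt (x : R -> R) : neglnet x -> neglnet (fun e => Num.sqrt `|x e|).
Proof.
move=> /neglnetP h; apply/neglnetP => N N0.
(* The order is doubled because the square root halves it. *)
have h2 := h _ (addr_gt0 N0 N0).
near=> e; rewrite ger0_norm ?sqrtr_ge0//.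
have r0 : 0 < rho e by near: e; exact: gauge_gt0.
have xe : `|x e| <= rho e `^ (N + N) by near: e.
rewrite -[leRHS]ger0_norm ?powR_ge0// -[leRHS]sqrtr_sqr ler_wsqrtr// (le_trans xe)//.
by rewrite expr2 powRD// (lt0r_neq0 r0) implybT.
Unshelve. all: by end_near. Qed.

Lemma moderate_sqrt (x : R -> R) :
  x \in moderate rho R -> (fun e => Num.sqrt (x e)) \in moderate rho R.
Proof.
move=> /moderateP[N N0 h]; apply/moderateP; exists N => //.
near=> e; rewrite ger0_norm ?sqrtr_ge0//.
have r0 : 0 < rho e by near: e; exact: gauge_gt0.
have r1 : rho e <= 1 by near: e; exact: gauge_le1.
have xe : `|x e| <= rho e `^ (- N) by near: e.
rewrite -[leRHS]ger0_norm ?powR_ge0// -[leRHS]sqrtr_sqr ler_wsqrtr//.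
rewrite (le_trans (ler_norm _))// (le_trans xe)// expr2 -powRD; last first.
  by rewrite (lt0r_neq0 r0) implybT.
by apply: ger_powR; [rewrite r0|lra].
Unshelve. all: by end_near. Qed.

Lemma moderateS (V : normedModType R) (x y : R -> V) :
  x \in moderate rho V -> neglnet (fun e => x e - y e) -> y \in moderate rho V.
Proof.
move=> mx xy; have -> : y = x - (fun e => x e - y e).
  by apply/funext => e; rewrite !fctE subKr.
by rewrite rpredB// neglnet_moderate.
Qed.

Lemma gclass_eqP (V : normedModType R) (x y : R -> V) :
  x \in moderate rho V -> y \in moderate rho V ->
  gclass rho x = gclass rho y <-> neglnet (fun e => x e - y e).
Proof.
(* Moderateness rules out the default value of [gclass]; equality in the quotient is then membership
   of the difference in the ideal. *)
move=> mx my; rewrite /gclass /insubd !insubT/=.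
split=> [/eqP|] h.
  by move: h; rewrite -Quotient.idealrBE => /asboolP.
by apply/eqP; rewrite -Quotient.idealrBE; apply/asboolP.
Qed.

Lemma gclass0 (V : normedModType R) : gclass rho (fun=> 0 : V) = 0.
Proof.
rewrite /gclass (_ : insubd _ _ = 0); first exact: raddf0.
by apply: val_inj; rewrite val_insubd; case: ifP.
Qed.

Lemma gclass1 : gclass rho (fun=> 1 : R) = 1.
Proof.
rewrite /gclass (_ : insubd (0 : mnet rho R) _ = 1 :> mnet rho R).
  exact: rmorph1.
by apply: val_inj; rewrite val_insubd moderate1.
Qed.

End Nets.

(** * Uniform estimates on [0, 1] from nets of points *)

Section UnitInterval.
Context {R : realType} (rho : ggauge R).

(** Nets defining a generalized curve are controlled along nets of points only; letting the point
    vary with the parameter replaces a supremum over the interval. *)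
Definition net01 (t : R -> R) := forall e, 0 <= t e <= 1.

(* At each parameter, choose a point violating P whenever there is one. *)
Lemma net01_uniform (P : R -> R -> Prop) :
  (forall t, net01 t -> \forall e \near 0^'+, P e (t e)) ->
  \forall e \near 0^'+, forall s : R, 0 <= s <= 1 -> P e s.
Proof.
move=> h; pose t e := xget 0 [set s | 0 <= s <= 1 /\ ~ P e s].
have t01 : net01 t.
  by move=> e; rewrite /t; case: xgetP => [s _ [] //|_]; rewrite lexx ler01.
near=> e; have : P e (t e) by near: e; exact: h.
rewrite /t; case: xgetP => [s _ [] //|H _ s s01].
by apply: contrapT => nP; apply: (H s).
Unshelve. all: by end_near. Qed.

Lemma net01_moderate (t : R -> R) : net01 t -> t \in moderate rho R.
Proof.
move=> h; apply: (@moderate_bounded _ _ _ _ 1); near=> e.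
by have /andP[t0 t1] := h e; rewrite ger0_norm.
Unshelve. all: by end_near. Qed.

Lemma gint01_gclass (t : R -> R) : net01 t -> gint01 rho (gclass rho t).
Proof.
move=> h; have mt := net01_moderate h; split.
  exists (fun=> 0), t; split=> [||e _]; last by have /andP[] := h e.
    by split; [exact: neglnet_moderate (neglnet0 _ _)|exact: gclass0].
  by split.
exists t, (fun=> 1); split=> [||e _]; last by have /andP[] := h e.
  by split.
by split; [exact: moderate1|exact: gclass1].
Qed.

(** The moderateness hypothesis is applied to a net of points where [|f e|] attains its maximum,
    which exists by continuity for [e] small. *)
Lemma moderate_sup01 (f : R -> R -> R) :
  (\forall e \near 0^'+, {within `[0, 1], continuous (f e)}) ->
  (forall t, net01 t -> (fun e => f e (t e)) \in moderate rho R) ->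
  exists2 N, 0 < N &
    \forall e \near 0^'+, forall s : R, 0 <= s <= 1 -> `|f e s| <= rho e `^ (- N).
Proof.
move=> cf h; pose t e := xget 0 [set c | 0 <= c <= 1 /\
  forall s : R, 0 <= s <= 1 -> `|f e s| <= `|f e c|].
have t01 : net01 t.
  by move=> e; rewrite /t; case: xgetP => [s _ [] //|_]; rewrite lexx ler01.
have /moderateP[N N0 hN] := h _ t01.
exists N => //; near=> e => s s01.
apply: (@le_trans _ _ `|f e (t e)|); last by near: e.
rewrite /t; case: xgetP => [c _ [_]|]; first exact.
have cfe : {within `[0, 1], continuous (f e)} by near: e.
have [||c c01 hc] := @EVT_max R (fun s => `|f e s|) 0 1.
- exact: ler01.
- by move=> x; apply: continuous_comp; [exact: cfe|exact: norm_continuous].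
- by move=> /(_ c) []; split=> [|u u01]; [|apply: hc]; rewrite ?in_itv/= in c01 *.
Unshelve. all: by end_near. Qed.

Lemma lipschitz_of_derive_bound (f f1 : R -> R) (B a b : R) :
  (forall s : R, 0 <= s <= 1 -> is_derive s 1 f (f1 s)) ->
  (forall s : R, 0 <= s <= 1 -> `|f1 s| <= B) ->
  0 <= a <= 1 -> 0 <= b <= 1 -> `|f a - f b| <= B * `|a - b|.
Proof.
move=> df f1B; wlog ab : a b / a < b => [H|] a01 b01.
  have [ab|ab|->] := ltgtP a b; first exact: H.
    by rewrite distrC [X in B * X]distrC; exact: H.
  by rewrite !subrr normr0 mulr0.
have sub (s : R) : s \in `[a, b] -> 0 <= s <= 1.
  rewrite in_itv/= => /andP[as_ sb]; case/andP: a01 => a0 _; case/andP: b01 => _ b1.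
  by rewrite (le_trans a0)// (le_trans sb).
have [|||c cab fE] := @MVT R f f1 a b.
- exact: ab.
- by move=> s sab; apply: df; apply: sub; exact: subset_itv_oo_cc sab.
- apply: derivable_within_continuous => s sab.
  by have [] := df s (sub _ sab).
rewrite distrC [X in B * X]distrC fE normrM ler_wpM2r// f1B// sub//.
exact: subset_itv_oo_cc cab.
Qed.

(** On an interval of length [k] containing [t], the mean value theorem gives a point where the
    derivative is a difference quotient, at most [2 * A / k]; from there to [t] the derivative
    changes by at most [B * k]. *)
Lemma derive_bound (f f1 f2 : R -> R) (A B k t : R) : 0 < k -> k <= 2^-1 ->
  (forall s : R, 0 <= s <= 1 -> is_derive s 1 f (f1 s)) ->
  (forall s : R, 0 <= s <= 1 -> is_derive s 1 f1 (f2 s)) ->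
  (forall s : R, 0 <= s <= 1 -> `|f s| <= A) ->
  (forall s : R, 0 <= s <= 1 -> `|f2 s| <= B) ->
  0 <= t <= 1 -> `|f1 t| <= 2 * A / k + B * k.
Proof.
move=> k0 k2 df df1 fA f2B t01.
suff [a [b [ab a0 b1 atb]]] : exists a b, [/\ b - a = k, 0 <= a, b <= 1 & a <= t <= b].
  have ab' : a < b by lra.
  have sub (s : R) : s \in `[a, b] -> 0 <= s <= 1 by rewrite in_itv/=; lra.
  have [|||c cab] := @MVT R f f1 a b.
  - exact: ab'.
  - by move=> s sab; apply: df; apply: sub; exact: subset_itv_oo_cc sab.
  - by apply: derivable_within_continuous => s sab; have [] := df s (sub _ sab).
  rewrite ab => fE; have c01 : 0 <= c <= 1 by apply: sub; exact: subset_itv_oo_cc cab.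
  have -> : f1 t = (f b - f a) / k + (f1 t - f1 c).
    by rewrite fE mulfK ?gt_eqF// addrC subrK.
  apply: (le_trans (ler_normD _ _)); apply: lerD.
    rewrite normrM [`|k^-1|]gtr0_norm ?invr_gt0// ler_wpM2r ?invr_ge0 ?(ltW k0)//.
    rewrite (le_trans (ler_normB _ _))// mulrDl mul1r lerD// fA//; lra.
  apply: (le_trans (lipschitz_of_derive_bound df1 f2B t01 c01)).
  apply: ler_wpM2l; first exact: le_trans (f2B _ t01).
  by move: cab; rewrite in_itv/= ler_norml => /andP[]; lra.
(* As [k <= 2^-1], the interval can start at [t] in the left half of [0, 1] and end at [t] in the
   right half. *)
have [t2|t2] := leP t 2^-1.
  by exists t, (t + k); split; lra.
by exists (t - k), t; split; lra.
Qed.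

(* Landau-Kolmogorov interpolation: |f'| <= 2 sup |f| / k + k sup |f''|, with k a
   suitable power of the gauge. *)
Lemma neglnet_derive (f f1 f2 : R -> R -> R) :
  (\forall e \near 0^'+, forall s : R, 0 <= s <= 1 -> is_derive s 1 (f e) (f1 e s)) ->
  (\forall e \near 0^'+, forall s : R, 0 <= s <= 1 -> is_derive s 1 (f1 e) (f2 e s)) ->
  (\forall e \near 0^'+, {within `[0, 1], continuous (f2 e)}) ->
  (forall t, net01 t -> neglnet rho (fun e => f e (t e))) ->
  (forall t, net01 t -> (fun e => f2 e (t e)) \in moderate rho R) ->
  forall t, net01 t -> neglnet rho (fun e => f1 e (t e)).
Proof.
move=> df df1 cf2 nf mf2 t t01 N N0.
have [M M0 hM] := moderate_sup01 cf2 mf2.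
(* Take k = rho^(N + M + 1). Then sup |f| <= rho^(2N + M + 1) gives 2 sup |f| / k <= 2 rho^N, and k
   sup |f''| <= rho^(N + 1) <= rho^N, hence the constant 3. The summand 1 in the exponent ensures k
   <= rho <= 1/2. *)
have A0 : \forall e \near 0^'+, forall s : R, 0 <= s <= 1 ->
    `|f e s| <= rho e `^ (N + (N + (M + 1))).
  apply: (@net01_uniform (fun e s => `|f e s| <= rho e `^ (N + (N + (M + 1))))).
  by move=> u u01; have /neglnetP := nf _ u01; apply; rewrite !addr_gt0.
exists 3; near=> e.
have r0 : 0 < rho e by near: e; exact: gauge_gt0.
have r1 : rho e <= 1 by near: e; exact: gauge_le1.
have r2 : rho e <= 2^-1.
  by near: e; apply: (gaugeP rho (nbhs_right_le _)); rewrite invr_gt0.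
have rD x y : rho e `^ (x + y) = rho e `^ x * rho e `^ y.
  by rewrite powRD// (lt0r_neq0 r0) implybT.
have N1 : 1 <= N + (M + 1) by lra.
have k2 : rho e `^ (N + (M + 1)) <= 2^-1.
  by rewrite (le_trans (ge1r_powR _ _))// r0.
apply: (@le_trans _ _ (2 * rho e `^ (N + (N + (M + 1))) / rho e `^ (N + (M + 1)) +
   rho e `^ (- M) * rho e `^ (N + (M + 1)))).
  apply: (@derive_bound (f e) (f1 e) (f2 e)) => //.
  - by rewrite powR_gt0.
  - by near: e.
  - by near: e.
  - by near: e.
  - by near: e.
rewrite -rD (rD N (N + _)) mulrA mulfK ?gt_eqF ?powR_gt0//.
have -> : - M + (N + (M + 1)) = N + 1 by lra.
rewrite rD powRr1 ?(ltW r0)//.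
have : rho e `^ N * rho e <= rho e `^ N * 1 by rewrite ler_wpM2l ?powR_ge0.
lra.
Unshelve. all: by end_near. Qed.

End UnitInterval.

(** * Curves on [0, 1], one-sided derivatives and lengths *)

Section Curves.
Context {R : realType}.

(** Differentiability is two-sided, also at the end points: the curves met below are smooth on a
    neighbourhood of [0, 1]. *)
Definition C1_01 (V : normedModType R) (c : R -> V) := forall s : R, 0 <= s <= 1 ->
  (\forall r \near s, derivable c r 1) /\ {for s, continuous (fun r => 'D_1 c r)}.

Lemma itv01E (s : R) : (`[0, 1]%classic s : Prop) = (0 <= s <= 1).
Proof. by rewrite set_itvE. Qed.

Lemma within01_continuous (V : topologicalType) (f : R -> V) :
  (forall s : R, 0 <= s <= 1 -> {for s, continuous f}) ->
  {within `[0, 1], continuous f}.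
Proof.
by move=> h; apply: continuous_in_subspaceT => s /set_mem; rewrite itv01E; exact: h.
Qed.

Lemma derivable_continuous (V : normedModType R) (c : R -> V) (s : R) :
  derivable c s 1 -> {for s, continuous c}.
Proof. by move/derivable1_diffP; exact: differentiable_continuous. Qed.

(** Properness makes the limit in [dwithin] unique, at the end points too. *)
Lemma within_dnbhs_proper (t : R) : 0 <= t <= 1 ->
  ProperFilter (within `[0, 1] t^').
Proof.
move=> /andP[t0 t1]; split; last exact: within_filter.
move=> /nbhs_ballP[r/= r0 hr].
(* Half the radius, cut off at the distance to an end point, is a step staying in the ball and in
   the interval: to the right if [t < 1], to the left otherwise. *)
have [t2|t2] := ltP t 1.
  have := hr (t + Num.min (r / 2) (1 - t)); rewrite /ball/= in_itv/=.
  have m0 : 0 < Num.min (r / 2) (1 - t) by rewrite lt_min divr_gt0//= subr_gt0.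
  have m1 : Num.min (r / 2) (1 - t) <= 1 - t by rewrite ge_min lexx orbT.
  have m2 : Num.min (r / 2) (1 - t) <= r / 2 by rewrite ge_min lexx.
  rewrite opprD addrA subrr add0r normrN gtr0_norm//; apply; first lra.
  - by rewrite -subr_eq0 addrAC subrr add0r gt_eqF.
  - lra.
have := hr (t - Num.min (r / 2) t); rewrite /ball/= in_itv/=.
have m0 : 0 < Num.min (r / 2) t by rewrite lt_min divr_gt0//=; lra.
have m1 : Num.min (r / 2) t <= t by rewrite ge_min lexx orbT.
have m2 : Num.min (r / 2) t <= r / 2 by rewrite ge_min lexx.
rewrite opprB addrC subrK gtr0_norm//; apply; first lra.
- by rewrite -subr_eq0 addrAC subrr add0r oppr_eq0 gt_eqF.
- lra.
Qed.

(** The quotients of [c'] and [c] coincide on [0, 1], and a two-sided limit restricts to the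
    interval. Two curves are allowed because [ye e] is given on [0, 1] only, whereas a net defining
    [y] extends it smoothly. *)
Lemma dquot_cvg (V : normedModType R) (c c' : R -> V) (t : R) :
  {in `[0, 1], c' =1 c} -> 0 <= t <= 1 -> derivable c t 1 ->
  dquot c' t @ within `[0, 1] t^' --> 'D_1 c t.
Proof.
move=> cc' t01 dc.
apply: (@cvg_trans _ (dquot c t @ within `[0, 1] t^')).
  apply: near_eq_cvg; rewrite near_withinE; near=> s => s01.
  by rewrite /dquot !cc'// inE/= in_itv.
apply: (@cvg_trans _ (dquot c t @ t^')).
  by apply: cvg_app; exact: cvg_within.
(* The substitution h = s - t turns [dquot] into the quotient whose limit at 0 is ['D_1 c t]. *)
have -> : dquot c t = (fun h => h^-1 *: ((c \o shift t) (h *: 1) - c t)) \o (fun s => s - t).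
  apply/funext => s; rewrite /dquot/= [_ *: 1]mulr1 subrK//.
set D := (X in X \o _). have {}dc : D @ 0^' --> 'D_1 c t := dc.
move=> P /dc hP; have {hP} h : nbhs (0 : R) (fun y => y != 0 -> P (D y)) := hP.
have ct : (fun s : R => s - t) @ t --> (0 : R).
  by rewrite -[X in _ --> X](subrr t); apply: cvgB => //; exact: cvg_cst.
have {}h : nbhs t (fun s => s - t != 0 -> P (D (s - t))) := ct _ h.
change (nbhs t (fun s => s != t -> P (D (s - t)))).
by apply: filterS h => s /= hs st; apply: hs; rewrite subr_eq0.
Unshelve. all: by end_near. Qed.

Lemma dwithinE (V : normedModType R) (c c' : R -> V) (t : R) :
  {in `[0, 1], c' =1 c} -> 0 <= t <= 1 -> derivable c t 1 ->
  dwithin `[0, 1] c' t = 'D_1 c t.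
Proof.
move=> cc' t01 dc; have FF := within_dnbhs_proper t01.
by apply: cvg_lim; [exact: norm_hausdorff|exact: dquot_cvg].
Qed.

(** The trivial subdivision with the single piece [0, 1] works; this admits such curves as
    competitors in [length_minimizing]. *)
Lemma C1_01_piecewise (V : normedModType R) (c : R -> V) :
  C1_01 c -> piecewise_C1 c.
Proof.
move=> h; exists [:: 1]; split=> //=; first by rewrite ltr01.
case=> // _ /= j.
have dc s : 0 <= s <= 1 -> derivable c s 1.
  by move=> /h[/nbhs_singleton].
split=> [j1|]; last first.
  case: j => // _ t; rewrite itv01E => t01; apply/cvg_ex; exists ('D_1 c t).
  by apply: dquot_cvg => //; exact: dc.
case: j j1 => [|[|//]] _ /=.
  by apply: within01_continuous => s s01; apply: derivable_continuous; exact: dc.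
apply: (@subspace_eq_continuous _ _ _ (fun r => 'D_1 c r)).
  move=> s /set_mem; rewrite itv01E => s01.
  by symmetry; apply: (@dwithinE V c c) => //; exact: dc.
by apply: within01_continuous => s s01; case: (h _ s01).
Qed.

Lemma Rintegral01_dist (f g : R -> R) (C : R) :
  {within `[0, 1], continuous f} -> {within `[0, 1], continuous g} ->
  (forall s : R, 0 <= s <= 1 -> `|f s - g s| <= C) ->
  `|(\int[lebesgue_measure]_(t in `[0, 1]) f t)%R -
    (\int[lebesgue_measure]_(t in `[0, 1]) g t)%R| <= C.
Proof.
move=> cf cg fg.
have cI (h : R -> R) : {within `[0, 1], continuous h} ->
    lebesgue_measure.-integrable `[0, 1] (EFin \o h).
  by apply: continuous_compact_integrable; exact: segment_compact.
have cfg : {within `[0, 1], continuous (fun t => f t - g t)}.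
  by move=> x; apply: cvgB; [exact: cf|exact: cg].
rewrite -RintegralB//; [|exact: cI..].
apply: (le_trans (le_normr_Rintegral _ _)) => //; first exact: cI.
(* The interval has measure 1, so the constant is its own integral. *)
have -> : C = (\int[lebesgue_measure]_(t in `[0, 1]) (fun=> C) t)%R.
  have mu1 : lebesgue_measure `[0, 1 : R] = 1%:E.
    by rewrite lebesgue_measure_itv/= lte_fin ltr01 sube0.
  by rewrite Rintegral_cst//= [X in fine X]mu1 mulr1.
apply: le_Rintegral => //.
- by apply: cI => x; apply: cvg_norm; exact: cfg.
- by apply: cI => x; exact: cvg_cst.
Qed.

(** The integrand of [curve_length], with the two-sided derivative in place of [dwithin]. *)
Definition speed d (h : 'rV[R]_d -> 'M[R]_d) (c : R -> 'rV[R]_d) (t : R) : R :=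
  Num.sqrt (qform (h (c t)) ('D_1 c t)).

Lemma curve_lengthE d (h : 'rV[R]_d -> 'M[R]_d) (c c' : R -> 'rV[R]_d) :
  {in `[0, 1], c' =1 c} -> C1_01 c ->
  curve_length h c' = (\int[lebesgue_measure]_(t in `[0, 1]) speed h c t)%R.
Proof.
move=> cc' hc; apply: eq_Rintegral => t /set_mem t01; rewrite /speed cc'; last by rewrite inE.
rewrite itv01E in t01.
by rewrite (@dwithinE _ c)//; case: (hc _ t01) => /nbhs_singleton.
Qed.

Lemma cvg_sum_fun (I : Type) (r : seq I) (T : Type) (F : set_system T)
    (FF : Filter F) (f : I -> T -> R) (l : I -> R) :
  (forall i, f i @ F --> l i) ->
  (fun x => \sum_(i <- r) f i x) @ F --> \sum_(i <- r) l i.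
Proof. by move=> h; apply: cvg_big => //; exact: add_continuous. Qed.

Lemma speed_continuous d (h : 'rV[R]_d -> 'M[R]_d) (c : R -> 'rV[R]_d) :
  (forall i j, continuous (fun x => h x i j)) -> C1_01 c ->
  {within `[0, 1], continuous (speed h c)}.
Proof.
move=> ch hc; apply: within01_continuous => s s01.
have [/nbhs_singleton/derivable_continuous cc cD] := hc _ s01.
have cDi i : (fun r => 'D_1 c r 0 i) @ s --> 'D_1 c s 0 i.
  by apply: (@continuous_comp _ _ _ (fun r => 'D_1 c r) (fun M : 'rV[R]_d => M 0 i));
    [exact: cD|exact: coord_continuous].
apply: (@continuous_comp _ _ _ (fun r => qform (h (c r)) ('D_1 c r)) Num.sqrt);
  last exact: sqrt_continuous.
apply: cvg_sum_fun => i; apply: cvg_sum_fun => j.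
apply: cvgM => //; apply: cvgM => //.
by apply: (@continuous_comp _ _ _ c (fun x => h x i j)); [exact: cc|exact: ch].
Qed.

(** For [0 <= b <= a], square [Num.sqrt (a - b) + Num.sqrt b] and drop the mixed term; for [b < 0]
    the root of [b] is 0 and [a <= a - b]. *)
Lemma sqrt_dist (a b : R) : `|Num.sqrt a - Num.sqrt b| <= Num.sqrt `|a - b|.
Proof.
wlog ba : a b / b <= a => [H|].
  by have [/H//|/ltW/H] := leP b a; rewrite distrC [`|a - b|]distrC.
rewrite ger0_norm ?subr_ge0 ?ler_wsqrtr// ger0_norm ?subr_ge0//.
have [b0|/ltW b0] := leP 0 b; last first.
  by rewrite (ler0_sqrtr b0) subr0 ler_wsqrtr// lerDl oppr_ge0.
rewrite lerBlDr -(@ler_pXn2r _ 2)// ?nnegrE ?addr_ge0 ?sqrtr_ge0//.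
rewrite sqrrD !sqr_sqrtr ?subr_ge0// ?(le_trans b0)//.
have : 0 <= Num.sqrt (a - b) * Num.sqrt b by rewrite mulr_ge0 ?sqrtr_ge0.
lra.
Qed.

Lemma is_derive_coord d (c : R -> 'rV[R]_d) (s : R) i : derivable c s 1 ->
  is_derive s 1 (fun r => c r 0 i) ('D_1 c s 0 i).
Proof.
move=> dc; split; first by move/derivable_mxP : dc.
by rewrite (derive_mx dc) mxE.
Qed.

(** The added term runs affinely from [p - c 0] at 0 to [q - c 1] at 1. *)
Definition shift_ends (V : normedModType R) (c : R -> V) (p q : V) (s : R) : V :=
  c s + ((p - c 0) + s *: (q - c 1 - (p - c 0))).

Lemma is_derive_shift_ends (V : normedModType R) (c : R -> V) (p q : V) (s : R) :
  derivable c s 1 ->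
  is_derive s 1 (shift_ends c p q) ('D_1 c s + (q - c 1 - (p - c 0))).
Proof.
move=> dc; set b := q - c 1 - (p - c 0).
have -> : shift_ends c p q = c + (cst (p - c 0) + (fun r => r *: b)) by [].
(* The inserted 0 is the derivative of the constant summand. *)
rewrite -[X in is_derive _ _ _ (_ + X)]add0r.
have db : is_derive s 1 (fun r => r *: b) b.
  have [dl ll] := is_diff_scalel s b.
  split; first exact/derivable1_diffP.
  by rewrite deriveE// ll scale1r.
have dc' : is_derive s 1 c ('D_1 c s) by split.
by apply: is_deriveD.
Qed.

Lemma shift_ends0 (V : normedModType R) (c : R -> V) (p q : V) :
  shift_ends c p q 0 = p.
Proof. by rewrite /shift_ends scale0r addr0 addrC subrK. Qed.

Lemma shift_ends1 (V : normedModType R) (c : R -> V) (p q : V) :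
  shift_ends c p q 1 = q.
Proof. by rewrite /shift_ends scale1r [p - _ + _]addrC subrK addrC subrK. Qed.

Lemma C1_01_shift_ends (V : normedModType R) (c : R -> V) (p q : V) :
  C1_01 c -> C1_01 (shift_ends c p q).
Proof.
move=> h s s01; have [ds cs] := h _ s01; split.
  by apply: filterS ds => r dr; case: (is_derive_shift_ends p q dr).
have e r : derivable c r 1 -> 'D_1 (shift_ends c p q) r = 'D_1 c r + (q - c 1 - (p - c 0)).
  by move=> dr; case: (is_derive_shift_ends p q dr).
suff : (fun r => 'D_1 (shift_ends c p q) r) @ s --> 'D_1 c s + (q - c 1 - (p - c 0)).
  by rewrite -(e _ (nbhs_singleton ds)).
(* The formula for the derivative holds near [s], which is enough for the limit. *)
apply: (@cvg_trans _ ((fun r => 'D_1 c r + (q - c 1 - (p - c 0))) @ s)).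
  by apply: near_eq_cvg; apply: filterS ds => r /e ->.
have {}cs : (fun r => 'D_1 c r) @ s --> 'D_1 c s := cs.
exact: (cvgD cs (cvg_cst _)).
Qed.

End Curves.

(** * Nets defining generalized smooth curves *)

Section GsfCurves.
Context {R : realType} (rho : ggauge R) {d : nat}.
Implicit Types c : R -> R -> 'rV[R]_d.

Lemma near_I0 : \forall e \near (0 : R)^'+, I0 e.
Proof.
near=> e; apply/andP; split; near: e; first exact: nbhs_right_gt.
by apply: nbhs_right_le; exact: ltr01.
Unshelve. all: by end_near. Qed.

Definition smooth01 (V : normedModType R) (c : R -> V) :=
  exists2 U : set R, open U /\ (forall s : R, 0 <= s <= 1 -> U s)
    & Cinf_on (@rbasis R) U c.

(** Strong membership puts every net of points of [0, 1] eventually into the domains; by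
    [net01_uniform] these contain the whole interval for [e] small. *)
Lemma gsf_net_smooth01 (V : normedModType R) (c : R -> R -> V) f :
  gsf_net (@rbasis R) (gint01 rho) c f -> \forall e \near 0^'+, smooth01 (c e).
Proof.
move=> [Om [sOm sub _]].
have h : \forall e \near (0 : R)^'+, forall s : R, 0 <= s <= 1 -> Om e s.
  apply: net01_uniform => t t01; apply: (sub _ (gint01_gclass rho t01)).
  by split=> //; exact: net01_moderate.
near=> e; have [oOm cOm] : open (Om e) /\ Cinf_on (@rbasis R) (Om e) (c e).
  by apply: sOm; near: e; exact: near_I0.
by exists (Om e) => //; split=> //; near: e.
Unshelve. all: by end_near. Qed.

(** In one variable the list [nseq k tt] encodes the derivative of order [k]. Differentiability of
    order [k + 1] is used at the list of length [k], and continuity at that of length [k + 1]. *)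
Lemma smooth01_pderive (V : normedModType R) (c : R -> V) k : smooth01 c ->
  C1_01 (pderive (@rbasis R) (nseq k tt) c).
Proof.
move=> [U [oU U01] cU] s s01; split.
  have : nbhs s U by apply: open_nbhs_nbhs; split=> //; exact: U01.
  apply: filterS => r Ur; have [_] := cU k.+1 (nseq k tt) r Ur.
  by rewrite size_nseq => /(_ (ltnSn k) tt).
have [+ _] := cU k.+1 (nseq k.+1 tt) s (U01 _ s01).
by rewrite size_nseq => /(_ (leqnn _)).
Qed.

Lemma gsf_net_pderive_moderate (V : normedModType R) (c : R -> R -> V) f t k :
  gsf_net (@rbasis R) (gint01 rho) c f -> net01 t ->
  (fun e => pderive (@rbasis R) (nseq k tt) (c e) (t e)) \in moderate rho V.
Proof.
move=> [Om [_ _ h]] t01.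
have [|H _] := h _ t (gint01_gclass rho t01); last exact: H.
by split=> //; exact: net01_moderate.
Qed.

Lemma gsf_net_rep (V : normedModType R) (c : R -> R -> V) f t :
  gsf_net (@rbasis R) (gint01 rho) c f -> net01 t ->
  rep (fun e => c e (t e)) (f (gclass rho t)).
Proof.
move=> [Om [_ _ h]] t01.
by have [|_ H] := h _ t (gint01_gclass rho t01); [split=> //; exact: net01_moderate|].
Qed.

Lemma rep_neglnet (V : normedModType R) (x y : R -> V) (z : gspace rho V) :
  rep x z -> rep y z -> neglnet rho (fun e => x e - y e).
Proof. by move=> [mx xz] [my yz]; apply/gclass_eqP => //; rewrite xz yz. Qed.

(** A defining net exists, so the default of [xget] is not taken. *)
Lemma curve_net_gsf (lam : gspace rho R -> gspace rho 'rV[R]_d) Y :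
  GCinf (@rbasis R) (gint01 rho) Y lam ->
  gsf_net (@rbasis R) (gint01 rho) (curve_net lam) lam.
Proof. by move=> [_ [c hc]]; apply: (@xgetPex _ _ [set c | gsf_net _ _ c lam]); exists c. Qed.

Lemma moderate_coord n (x : R -> 'rV[R]_n) i :
  x \in moderate rho 'rV[R]_n -> (fun e => x e 0 i) \in moderate rho R.
Proof.
move=> mx; apply: moderate_le mx _; near=> e.
rewrite [leRHS]mx_normrE.
exact: (le_trans _ (le_bigmax _ (fun ij : 'I_1 * 'I_n => `|x e ij.1 ij.2|) (0, i))).
Unshelve. all: by end_near. Qed.

Lemma neglnet_coord n (x y : R -> 'rV[R]_n) i :
  neglnet rho (fun e => x e - y e) -> neglnet rho (fun e => x e 0 i - y e 0 i).
Proof.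
move=> nx; apply: neglnet_le nx _; near=> e.
rewrite [leRHS]mx_normrE.
apply: (le_trans _ (le_bigmax _ (fun ij : 'I_1 * 'I_n => `|(x e - y e) ij.1 ij.2|) (0, i))).
by rewrite !mxE.
Unshelve. all: by end_near. Qed.

(** Interpolation is applied to the difference of the coordinates: its values are negligible since
    both nets represent [f], and its second derivatives are moderate since those of each net are. *)
Lemma gsf_net_derive_neglnet c1 c2 f t i :
  gsf_net (@rbasis R) (gint01 rho) c1 f -> gsf_net (@rbasis R) (gint01 rho) c2 f ->
  net01 t -> neglnet rho (fun e => 'D_1 (c1 e) (t e) 0 i - 'D_1 (c2 e) (t e) 0 i).
Proof.
move=> h1 h2; have s1 := gsf_net_smooth01 h1; have s2 := gsf_net_smooth01 h2.
pose D k c e s : R := pderive (@rbasis R) (nseq k tt) (c e) s 0 i.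
have dD k c f' : gsf_net (@rbasis R) (gint01 rho) c f' ->
    \forall e \near 0^'+, forall s : R, 0 <= s <= 1 ->
      is_derive s 1 (D k c e) (D k.+1 c e s).
  move=> /gsf_net_smooth01 hc; near=> e => s s01; apply: is_derive_coord.
  have sc : smooth01 (c e) by near: e.
  by have [/nbhs_singleton] := smooth01_pderive k sc s01.
have dB k : \forall e \near 0^'+, forall s : R, 0 <= s <= 1 ->
      is_derive s 1 (fun r => D k c1 e r - D k c2 e r) (D k.+1 c1 e s - D k.+1 c2 e s).
  apply: filterS2 (dD k _ _ h1) (dD k _ _ h2) => e de1 de2 s s01.
  exact: is_deriveB (de1 s s01) (de2 s s01).
apply: (neglnet_derive (dB 0%N) (dB 1%N)).
(* Third derivatives enter only through the continuity of the second ones. *)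
- near=> e; apply: within01_continuous => s s01; apply: derivable_continuous.
  have : forall s : R, 0 <= s <= 1 ->
      is_derive s 1 (fun r => D 2%N c1 e r - D 2%N c2 e r) (D 3%N c1 e s - D 3%N c2 e s).
    by near: e; exact: dB.
  by move=> /(_ s s01)[].
- move=> u u01; apply: neglnet_coord.
  exact: rep_neglnet (gsf_net_rep h1 u01) (gsf_net_rep h2 u01).
- move=> u u01; apply: (rpredB (S := moderate rho R));
    apply: (@moderate_coord _ (fun e => pderive _ _ _ (u e)));
    [exact: gsf_net_pderive_moderate h1 u01|exact: gsf_net_pderive_moderate h2 u01].
Unshelve. all: by end_near. Qed.

(** * Lengths of nets of curves for the regularized metric *)

Section Lengths.
Variable ge : R -> 'rV[R]_d -> 'M[R]_d.
Variable gtil : 'I_d -> 'I_d -> gspace rho 'rV[R]_d -> gspace rho R.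
Hypothesis smooth_ge : forall e, I0 e -> smooth_metric (ge e).
Hypothesis gsf_ge : forall i j,
  gsf_net (@rvbasis R d) setT (fun e x => ge e x i j) (gtil i j).

Lemma metric_continuous e i j : I0 e -> continuous (fun x => ge e x i j).
Proof.
move=> /smooth_ge h x.
by have [+ _] := h i j 0%N [::] x I; exact.
Qed.

Lemma metric_moderate (a : R -> 'rV[R]_d) i j : a \in moderate rho 'rV[R]_d ->
  (fun e => ge e (a e) i j) \in moderate rho R.
Proof.
move=> ma; have [Om [_ _ h]] := gsf_ge i j.
by have [|_ []] := h (gclass rho a) a I; [split|].
Qed.

(** Both nets represent one generalized point, where [gtil i j] has a single value; this takes the
    place of a Lipschitz estimate for the metric. *)
Lemma metric_neglnet (a b : R -> 'rV[R]_d) i j : a \in moderate rho 'rV[R]_d ->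
  neglnet rho (fun e => a e - b e) ->
  neglnet rho (fun e => ge e (a e) i j - ge e (b e) i j).
Proof.
move=> ma ab; have mb := moderateS ma ab; have [Om [_ _ h]] := gsf_ge i j.
have [|_ ha] := h (gclass rho a) a I; first by split.
have [|_ hb] := h (gclass rho a) b I; first by split=> //; apply/esym/gclass_eqP.
exact: rep_neglnet ha hb.
Qed.

Section TwoCurves.
Variables c1 c2 : R -> R -> 'rV[R]_d.
Hypothesis C1_c1 : \forall e \near 0^'+, C1_01 (c1 e).
Hypothesis c1_moderate : forall t, net01 t ->
  (fun e => c1 e (t e)) \in moderate rho 'rV[R]_d.
Hypothesis Dc1_moderate : forall t, net01 t ->
  (fun e => 'D_1 (c1 e) (t e)) \in moderate rho 'rV[R]_d.

Lemma qform_moderate t : net01 t ->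
  (fun e => qform (ge e (c1 e (t e))) ('D_1 (c1 e) (t e))) \in moderate rho R.
Proof.
move=> t01.
(* As a sum of nets the form falls under the closure of moderate nets under sums. *)
have -> : (fun e => qform (ge e (c1 e (t e))) ('D_1 (c1 e) (t e))) =
  \sum_i \sum_j (fun e => ge e (c1 e (t e)) i j *
    'D_1 (c1 e) (t e) 0 i * 'D_1 (c1 e) (t e) 0 j).
  by apply/funext => e; rewrite fct_sumE; apply: eq_bigr => i _; rewrite fct_sumE.
apply: rpred_sum => i _; apply: rpred_sum => j _.
by apply: moderateM; [apply: moderateM|];
  [exact: metric_moderate (c1_moderate t01)|exact: moderate_coord (Dc1_moderate t01)..].
Qed.

Lemma moderate_speed t : net01 t ->
  (fun e => speed (ge e) (c1 e) (t e)) \in moderate rho R.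
Proof.
by move=> t01; apply: moderate_sqrt; exact: qform_moderate.
Qed.

Lemma moderate_length : (fun e => curve_length (ge e) (c1 e)) \in moderate rho R.
Proof.
have [||N N0 hN] := @moderate_sup01 _ rho (fun e => speed (ge e) (c1 e)).
- near=> e; apply: speed_continuous; last by near: e.
  by move=> i j; apply: metric_continuous; near: e; exact: near_I0.
- exact: moderate_speed.
apply/moderateP; exists N => //; near=> e.
have ce : C1_01 (c1 e) by near: e.
rewrite (@curve_lengthE _ _ _ (c1 e))//.
(* Subtracting the integral of 0 reduces the bound to [Rintegral01_dist]. *)
have -> : (\int[lebesgue_measure]_(t in `[0, 1]) speed (ge e) (c1 e) t)%R =
  (\int[lebesgue_measure]_(t in `[0, 1]) speed (ge e) (c1 e) t)%R -
  (\int[lebesgue_measure]_(t in `[0, 1]) (fun=> 0) t)%R.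
  by rewrite Rintegral_cst// mul0r subr0.
apply: Rintegral01_dist.
- apply: speed_continuous => // i j; apply: metric_continuous.
  by near: e; exact: near_I0.
- by move=> x; exact: cvg_cst.
- by move=> s s01; rewrite subr0; move: s s01; near: e.
Unshelve. all: by end_near. Qed.

Hypothesis C1_c2 : \forall e \near 0^'+, C1_01 (c2 e).
Hypothesis c12 : forall t, net01 t -> neglnet rho (fun e => c1 e (t e) - c2 e (t e)).
Hypothesis Dc12 : forall t i, net01 t ->
  neglnet rho (fun e => 'D_1 (c1 e) (t e) 0 i - 'D_1 (c2 e) (t e) 0 i).

(** By [sqrt_dist] it suffices to compare the quadratic forms, the root of a negligible net being
    negligible; thus no lower bound on the speed enters. *)
Lemma neglnet_speed t : net01 t ->
  neglnet rho (fun e => speed (ge e) (c1 e) (t e) - speed (ge e) (c2 e) (t e)).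
Proof.
move=> t01.
suff nq : neglnet rho (fun e => qform (ge e (c1 e (t e))) ('D_1 (c1 e) (t e)) -
    qform (ge e (c2 e (t e))) ('D_1 (c2 e) (t e))).
  apply: neglnet_le (neglnet_sqrt nq) _; near=> e.
  by rewrite [leRHS]ger0_norm ?sqrtr_ge0//; exact: sqrt_dist.
rewrite /qform; under eq_fun do rewrite -sumrB.
apply: neglnet_sum => i; under eq_fun do rewrite -sumrB.
apply: neglnet_sum => j; apply: neglnetM2; last exact: Dc12.
- by apply: moderateM; [exact: metric_moderate (c1_moderate t01)
                       |exact: moderate_coord (Dc1_moderate t01)].
- apply: neglnetM2; last exact: Dc12.
  + exact: metric_moderate (c1_moderate t01).
  + by apply: metric_neglnet; [exact: c1_moderate|exact: c12].
  + exact: moderate_coord (Dc1_moderate t01).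
- exact: moderate_coord (Dc1_moderate t01).
Unshelve. all: by end_near. Qed.

Lemma neglnet_length :
  neglnet rho (fun e => curve_length (ge e) (c1 e) - curve_length (ge e) (c2 e)).
Proof.
apply/neglnetP => N N0.
have h : \forall e \near 0^'+, forall s : R, 0 <= s <= 1 ->
    `|speed (ge e) (c1 e) s - speed (ge e) (c2 e) s| <= rho e `^ N.
  apply: (@net01_uniform _ (fun e s =>
    `|speed (ge e) (c1 e) s - speed (ge e) (c2 e) s| <= rho e `^ N)) => t t01.
  by have /neglnetP := neglnet_speed t01; exact.
apply: filterS2 h (filterI near_I0 (filterI C1_c1 C1_c2)) => e hs [e0 [C1 C2]].
have cg i j : continuous (fun x => ge e x i j) by exact: metric_continuous.
rewrite (curve_lengthE (ge e) (c := c1 e) (c' := c1 e) (fun _ _ => erefl) C1).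
rewrite (curve_lengthE (ge e) (c := c2 e) (c' := c2 e) (fun _ _ => erefl) C2).
exact: Rintegral01_dist (speed_continuous cg C1) (speed_continuous cg C2) hs.
Qed.

End TwoCurves.
End Lengths.
End GsfCurves.

(** Here [x] and [y] stand for the lengths of [y] and [lam]. The pair [c <= k] bounds [x - y] from
    above, and [a <= b] bounds [y - x]. *)
Lemma dist_sandwich (R : realDomainType) (x y a b c k : R) : a <= b -> c <= k ->
  `|x - y| <= `|x - c| + `|y - k| + (`|y - a| + `|b - x|).
Proof.
move=> ab ck; rewrite ler_norml.
have := ler_norm (x - c); have := ler_norm (k - y); rewrite distrC.
have := ler_norm (y - a); have := ler_norm (b - x).
have := normr_ge0 (x - c); have := normr_ge0 (y - k).
have := normr_ge0 (y - a); have := normr_ge0 (b - x).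
move=> *; apply/andP; split; lra.
Qed.

(** * Negligible displacement of the end points *)

Section ShiftEnds.
Context {R : realType} (rho : ggauge R) {d : nat}.
Variables (c : R -> R -> 'rV[R]_d) (p q : 'rV[R]_d).
Hypothesis c0 : neglnet rho (fun e => p - c e 0).
Hypothesis c1 : neglnet rho (fun e => q - c e 1).

Lemma neglnet_shift_ends t : net01 t ->
  neglnet rho (fun e => c e (t e) - shift_ends (c e) p q (t e)).
Proof.
move=> t01; apply: neglnet_le (neglnetD (neglnet_norm c0) (neglnet_norm c1)) _.
near=> e; rewrite /shift_ends opprD addrA subrr add0r normrN.
(* Written as a convex combination, the displacement is bounded by the sum of the norms of the two
   end errors. *)
have -> (a b : 'rV[R]_d) : a + t e *: (b - a) = (1 - t e) *: a + t e *: b.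
  by rewrite scalerBr scalerBl scale1r addrA addrAC.
have /andP[t0 t1] := t01 e.
rewrite [leRHS]ger0_norm ?addr_ge0// (le_trans (ler_normD _ _))// lerD//.
  by rewrite normrZ ger0_norm ?subr_ge0// ler_piMl// gerBl.
by rewrite normrZ ger0_norm// ler_piMl.
Unshelve. all: by end_near. Qed.

(** The derivative of the affine displacement is the difference of the two end errors, whatever the
    point. *)
Lemma neglnet_derive_shift_ends t i : net01 t ->
  (\forall e \near 0^'+, C1_01 (c e)) ->
  neglnet rho (fun e => 'D_1 (c e) (t e) 0 i - 'D_1 (shift_ends (c e) p q) (t e) 0 i).
Proof.
move=> t01 hc; apply: neglnet_coord.
apply: neglnet_le (neglnetD (neglnet_norm c0) (neglnet_norm c1)) _.
apply: filterS hc => e /(_ (t e) (t01 e))[/nbhs_singleton dc _].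
have [_ ->] := is_derive_shift_ends p q dc.
rewrite opprD addrA subrr add0r opprB [leRHS]ger0_norm ?addr_ge0//.
exact: ler_normB.
Qed.

End ShiftEnds.

(** * Comparison of the two generalized lengths *)

Theorem corollary69 (R : realType) (rho : ggauge R) (d : nat)
  (b : R -> R) (psi : R -> 'rV[R]_d -> R) (hpsi : mollifier rho b psi)
  (g : 'rV[R]_d -> 'M[R]_d)
  (hg : riemannian g) (hgC11 : C11_metric g) (hgc : geodesically_complete g)
  (ge : R -> 'rV[R]_d -> 'M[R]_d)
  (hge : forall e, I0 e -> riemannian (ge e) /\ smooth_metric (ge e))
  (gtil : 'I_d -> 'I_d -> gspace rho 'rV[R]_d -> gspace rho R)
  (hgt : forall i j,
     gsf_net (@rvbasis R d) setT (fun e x => ge e x i j) (gtil i j))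
  (hgti : forall i j, is_embedding b psi (fun x => g x i j) (gtil i j))
  (hgcvg : {family compact, ge @ 0^'+ --> g})
  (hGcvg : forall i j, {family compact,
     (fun e => christoffel (ge e) i j) @ 0^'+ --> christoffel g i j})
  (p q : 'rV[R]_d) (hpq : p <> q)
  (u : R -> 'rV[R]_d)
  (huC2 : Ck_within 2 `[0, 1] u)
  (huLip : [lipschitz iter 2 (dwithin `[0, 1]) u t | t in `[0, 1]])
  (hugeo : geodesic g `[0, 1] u) (hu0 : u 0 = p) (hu1 : u 1 = q)
  (ye : R -> R -> 'rV[R]_d)
  (hysmooth : \forall e \near 0^'+, forall k, Ck_within k `[0, 1] (ye e))
  (hygeo : \forall e \near 0^'+, geodesic (ge e) `[0, 1] (ye e))
  (hy0 : \forall e \near 0^'+, ye e 0 = p)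
  (hdy0 : \forall e \near 0^'+,
     dwithin `[0, 1] (ye e) 0 = dwithin `[0, 1] u 0)
  (hy1 : \forall e \near 0^'+, ye e 1 = q)
  (y : gspace rho R -> gspace rho 'rV[R]_d)
  (hynet : exists2 c, gsf_net (@rbasis R) (gint01 rho) c y &
     \forall e \near 0^'+, forall t, 0 <= t <= 1 -> c e t = ye e t)
  (hy : GCpos p q y)
  (lam : gspace rho R -> gspace rho 'rV[R]_d)
  (hlam : GCpos p q lam) (hlammin : glength_minimizer ge p q lam)
  (hymin : \forall e \near 0^'+, length_minimizing (ge e) p q (ye e)) :
  glength ge y = glength ge lam.
Proof.
have smooth_ge e : I0 e -> smooth_metric (ge e) by move=> /hge[].
have [c gc cye] := hynet.
have [GCy _ _ _] := hy; have gy := curve_net_gsf GCy.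
have [GClam lam0 lam1 _] := hlam; have gl := curve_net_gsf GClam.
have C1_net f (k : R -> R -> 'rV[R]_d) :
    gsf_net (@rbasis R) (gint01 rho) k f -> \forall e \near 0^'+, C1_01 (k e).
  by move=> /gsf_net_smooth01; apply: filterS => e; exact: (@smooth01_pderive _ _ _ 0).
set ly := fun e => curve_length (ge e) (curve_net y e).
set ll := fun e => curve_length (ge e) (curve_net lam e).
have moderate_len f (k : R -> R -> 'rV[R]_d) : gsf_net (@rbasis R) (gint01 rho) k f ->
    (fun e => curve_length (ge e) (k e)) \in moderate rho R.
  move=> gk; apply: (moderate_length smooth_ge hgt (C1_net _ _ gk)) => t t01.
    exact: (gsf_net_pderive_moderate 0 gk t01).
  exact: (gsf_net_pderive_moderate 1 gk t01).
(* [glength] uses the chosen net [curve_net y], which may differ from the net [c] extending the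
   curves [ye e]. *)
have ly_c : neglnet rho (fun e => ly e - curve_length (ge e) (c e)).
  apply: (neglnet_length smooth_ge hgt (C1_net _ _ gy) _ _ (C1_net _ _ gc)) => t.
  - exact: (gsf_net_pderive_moderate 0 gy).
  - exact: (gsf_net_pderive_moderate 1 gy).
  - by move=> t01; exact: rep_neglnet (gsf_net_rep gy t01) (gsf_net_rep gc t01).
  - by move=> i t01; exact: gsf_net_derive_neglnet gy gc t01.
have ends (s : R) (v : 'rV[R]_d) : 0 <= s <= 1 ->
    lam (gclass rho (fun=> s)) = gclass rho (fun=> v) ->
    neglnet rho (fun e => v - curve_net lam e s).
  move=> s01 lamv; have [ml el] := gsf_net_rep gl (fun=> s01).
  apply/gclass_eqP => //; last by rewrite -lamv el.
  by apply: (@moderate_bounded _ _ _ _ `|v|); near=> e.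
have c0 : neglnet rho (fun e => p - curve_net lam e 0).
  by apply: ends; [rewrite lexx ler01|rewrite gclass0].
have c1 : neglnet rho (fun e => q - curve_net lam e 1).
  by apply: ends; [rewrite lexx ler01|rewrite gclass1].
pose k e := shift_ends (curve_net lam e) p q.
have C1k : \forall e \near 0^'+, C1_01 (k e).
  by apply: filterS (C1_net _ _ gl) => e; exact: C1_01_shift_ends.
have ll_k : neglnet rho (fun e => ll e - curve_length (ge e) (k e)).
  apply: (neglnet_length smooth_ge hgt (C1_net _ _ gl) _ _ C1k) => t.
  - exact: (gsf_net_pderive_moderate 0 gl).
  - exact: (gsf_net_pderive_moderate 1 gl).
  - exact: neglnet_shift_ends.
  - by move=> i t01; have := neglnet_derive_shift_ends c0 c1 i t01 (C1_net _ _ gl).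
have c_le_k : \forall e \near 0^'+,
    curve_length (ge e) (c e) <= curve_length (ge e) (k e).
  apply: filterS2 (filterI cye hymin) (filterI (C1_net _ _ gc) C1k) => e [ce mine] [C1c C1ke].
  (* Minimality concerns [ye e]; its length is that of [c e], since the two agree on [0, 1]. *)
  have yce : {in `[0, 1], ye e =1 c e}.
    by move=> t; rewrite in_itv/= => t01; rewrite ce.
  rewrite (curve_lengthE (ge e) (c := c e) (c' := c e) (fun _ _ => erefl) C1c).
  rewrite -(curve_lengthE (ge e) yce C1c).
  by apply: mine; [exact: C1_01_piecewise|exact: shift_ends0|exact: shift_ends1].
(* Minimality of [lam] is tested on [y] itself; the inequality holds between some representatives
   [a] and [b'], each negligibly far from the length net of [lam], respectively [y]. *)
have [a [b' [[ma ea] [mb eb] ab]]] := hlammin _ hy.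
have ll_a := neglnet_norm (rep_neglnet (conj (moderate_len _ _ gl) erefl) (conj ma ea)).
have b_ly := neglnet_norm (rep_neglnet (conj mb eb) (conj (moderate_len _ _ gy) erefl)).
apply/gclass_eqP; [exact: moderate_len gy|exact: moderate_len gl|].
apply: neglnet_le (neglnetD (neglnetD (neglnet_norm ly_c) (neglnet_norm ll_k))
  (neglnetD ll_a b_ly)) _.
apply: filterS2 (near_I0 (R := R)) c_le_k => e /ab abe ck.
rewrite [leRHS]ger0_norm ?addr_ge0//; exact: dist_sandwich.
Unshelve. all: by end_near. Qed.
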